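(* Let $(c_n),(d_n)$ be sequences of non-negative reals with $c_n=o(\log n)$, $d_n=o(\log n)$, and suppose the edge probabilities are $p_n=c_nn^{-1}\in[0,1]$ and $q_n=d_nn^{-1}\in[0,1]$ (Kesten-Stigum phase). For every $n\ge1$ let $\theta_n\in\Theta_n$, $X^n\sim P_{\theta_n}$, and choose the uniform prior on $\Theta_n$. If $$\frac{(c_n-d_n)^2}{2(c_n+d_n)}\to\infty\qquad(n\to\infty),$$ then there exists a sequence $(a_n)$ with $0<a_n<1/2$ and $a_n\to0$ such that the posterior recovers the true community assignment almost exactly with error rate $k_n=a_nn$, i.e. $P_{\theta_n}\Pi(B_n(\theta_n,a_nn)\mid X^n)\to1$ as $n\to\infty$.
   Context: Stochastic block model with two communities: for $n\ge1$ and $0\le m\le\lfloor n/2\rfloor$ let $\Theta_{n,m}=\{\theta_n\in\{0,1\}^n:\sum_i\theta_{n,i}=m\}$, except that for even $n$ and $m=n/2$, $\Theta_{n,n/2}=\{\theta_n\in\{0,1\}^n:\sum_i\theta_{n,i}=n/2,\ \theta_{n,1}=0\}$. Let $\Theta_n=\bigcup_{m=0}^{\lfloor n/2\rfloor}\Theta_{n,m}$; it has $2^{n-1}$ elements. Let $p_n,q_n\in[0,1]$. Under $P_{\theta_n}$ the observed random graph $X^n=\{X_{ij}:1\le i<j\le n\}\in\mathscr{X}_n=\{0,1\}^{\{(i,j):1\le i<j\le n\}}$ has independent edges with $P_{\theta_n}(X_{ij}=1)=Q_{ij}(\theta_n)$, where $Q_{ij}(\theta_n)=p_n$ if $\theta_{n,i}=\theta_{n,j}$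 and $Q_{ij}(\theta_n)=q_n$ if $\theta_{n,i}\ne\theta_{n,j}$. Its probability mass function is $p_{\theta_n}(x^n)=\prod_{i<j}Q_{ij}(\theta_n)^{x_{ij}}(1-Q_{ij}(\theta_n))^{1-x_{ij}}$ (with $0^0=1$). The uniform prior gives mass $2^{-(n-1)}$ to each element of $\Theta_n$; the corresponding posterior is $\Pi(A\mid X^n)=\sum_{\theta\in A}p_{\theta}(X^n)\big/\sum_{\theta'\in\Theta_n}p_{\theta'}(X^n)$ for $A\subset\Theta_n$ (defined whenever the denominator is positive, which holds $P_{\theta_n}$-almost surely for each $\theta_n\in\Theta_n$). $P_{\theta_n}f(X^n)$ denotes the expectation of $f(X^n)$ under $P_{\theta_n}$. For $\theta_n,\eta_n\in\Theta_n$: $h(\theta_n,\eta_n)=\sum_i|\theta_{n,i}-\eta_{n,i}|$, $k(\theta_n,\eta_n)=\min\{h(\theta_n,\eta_n),\,n-h(\theta_n,\eta_n)\}$, and $B_n(\theta_n,r)=\{\eta_n\in\Theta_n:k(\eta_n,\theta_n)\le r\}$ for real $r\ge0$. *)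

(* Defs.v *)
From HB Require Import structures.
From mathcomp Require Import all_boot all_order all_algebra.
From mathcomp Require Import all_classical all_reals all_analysis.

Set Implicit Arguments.
Unset Strict Implicit.
Unset Printing Implicit Defensive.

Import Order.TTheory GRing.Theory Num.Theory.
Import numFieldNormedType.Exports.

Local Open Scope ring_scope.

(* Community assignments in {0,1}^n; [true] is the label 1 and the vertices
   1, ..., n are the ordinals 0, ..., n-1. *)
Definition labeling (n : nat) : finType := {ffun 'I_n -> bool}.

(* In the balanced case n = 2m the first vertex is labelled 0, so that exactly
   one of the two complementary labelings is kept.  Quantifying over the [i] of
   value 0 avoids requiring n to be a successor. *)
Definition Theta_m (n m : nat) : {set labeling n} :=
  [set t : labeling n | (\sum_(i < n) (t i : nat) == m)%N &&
    ((n == m.*2) ==> [forall i : 'I_n, (val i == 0)%N ==> ~~ t i])].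

Definition Theta (n : nat) : {set labeling n} :=
  (\bigcup_(m < n./2.+1) Theta_m n m)%SET.

Definition edge (n : nat) : finType := {e : 'I_n * 'I_n | (e.1 < e.2)%N}.

Definition graph (n : nat) : finType := {ffun edge n -> bool}.

Definition edge_prob (R : realType) (n : nat) (p q : R) (t : labeling n)
    (e : edge n) : R :=
  if t (val e).1 == t (val e).2 then p else q.

Definition sbm_pmf (R : realType) (n : nat) (p q : R) (t : labeling n)
    (x : graph n) : R :=
  \prod_(e : edge n) (edge_prob p q t e ^+ (x e : nat) *
                      (1 - edge_prob p q t e) ^+ (1 - (x e : nat))).

Definition sbm_expectation (R : realType) (n : nat) (p q : R) (t : labeling n)
    (f : graph n -> R) : R :=
  \sum_(x : graph n) sbm_pmf p q t x * f x.

(* Posterior for the uniform prior on [Theta n], whose constant mass cancels.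
   When the denominator vanishes the quotient is 0; such [x] have probability
   0 under every [t \in Theta n]. *)
Definition posterior (R : realType) (n : nat) (p q : R) (A : {set labeling n})
    (x : graph n) : R :=
  (\sum_(t in A) sbm_pmf p q t x) / (\sum_(t in Theta n) sbm_pmf p q t x).

Definition hamming (n : nat) (t u : labeling n) : nat :=
  (\sum_(i < n) `|(t i : nat) - (u i : nat)|)%N.

Definition kdist (n : nat) (t u : labeling n) : nat :=
  minn (hamming t u) (n - hamming t u).

Definition kball (R : realType) (n : nat) (t : labeling n) (r : R) :
    {set labeling n} :=
  [set u in Theta n | (kdist u t)%:R <= r].

(* Main.v *)
Require Import Defs.
From mathcomp Require Import all_boot all_order all_algebra.
From mathcomp Require Import all_classical all_reals all_analysis.
From mathcomp Require Import ring lra zify.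

Import Order.TTheory GRing.Theory Num.Theory.
Import numFieldNormedType.Exports.

(** The posterior expectation is controlled by pairwise comparisons of
    hypotheses.  For the true labeling t and another labeling u, the posterior
    mass of u is p_u / Z, where the normalizer Z dominates both p_t and
    p_u, hence also sqrt (p_t p_u); so the expected posterior mass of u under
    P_t is at most the Hellinger affinity sum_x sqrt (p_t(x) p_u(x))
    ([posterior_defect]).  Edges are independent, so this affinity is a power
    of the affinity of the Bernoulli laws with parameters p and q, the exponent
    being the number of pairs of vertices on whose status (same or different
    community) t and u disagree ([hellingerE]).  If t and u differ at h
    vertices there are at least h (n - h) such pairs, hence at least k n / 2
    with k = min (h, n - h) ([kdist_cut_edges]).

    The Bernoulli affinity is at most 1 - (p - q)^2 / (4 (p + q)), by
    [affinity_le].  With p = c / n, q = d / n and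
    g = (c - d)^2 / (2 (c + d)), the labeling u therefore has expected posterior
    mass at most exp (- g k / 4) ([hellinger_sparse_le]).  When k > a n with
    a = 8 / g, this is at most exp (- 2 n), which beats the crude bound
    2^n <= exp n on the number of labelings: the expected posterior mass outside
    the ball is at most exp (- n) ([posterior_kball_ge]).  Since g tends to
    infinity, a tends to 0. *)

Set Implicit Arguments.
Unset Strict Implicit.
Unset Printing Implicit Defensive.

Local Open Scope ring_scope.

(** * The edge laws and their Hellinger affinity *)

Lemma sbm_pmf_ge0 (R : realType) (n : nat) (p q : R) (t : labeling n)
    (x : graph n) (p01 : 0 <= p <= 1) (q01 : 0 <= q <= 1) :
  0 <= sbm_pmf p q t x.
Proof.
apply: prodr_ge0 => e _.
have /andP[Q0 Q1] : 0 <= edge_prob p q t e <= 1.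
  by rewrite /edge_prob; case: ifP.
by rewrite mulr_ge0 // exprn_ge0 // subr_ge0.
Qed.

Lemma sum_sbm_pmf (R : realType) (n : nat) (p q : R) (t : labeling n) :
  \sum_(x : graph n) sbm_pmf p q t x = 1.
Proof.
transitivity (\prod_(e : edge n) \sum_(b : bool)
    (edge_prob p q t e ^+ b * (1 - edge_prob p q t e) ^+ (1 - b))).
  by rewrite bigA_distr_bigA.
rewrite big1 // => e _.
by rewrite big_bool /= expr1 expr0 mulr1 mul1r expr1 addrC subrK.
Qed.

(** The affinity (Bhattacharyya coefficient) of the graph laws under two
    labelings: 1 minus their squared Hellinger distance, in the normalization
    with values in [0, 1]. *)
Definition hellinger (R : realType) (n : nat) (p q : R) (t u : labeling n) : R :=
  \sum_(x : graph n) Num.sqrt (sbm_pmf p q t x * sbm_pmf p q u x).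

(** The same coefficient for two Bernoulli laws. *)
Definition affinity (R : realType) (p q : R) : R :=
  Num.sqrt (p * q) + Num.sqrt ((1 - p) * (1 - q)).

Lemma sqrt_prod (R : realType) (I : finType) (F : I -> R) :
  (forall i, 0 <= F i) ->
  Num.sqrt (\prod_i F i) = \prod_i Num.sqrt (F i).
Proof.
move=> F0.
suff [_ ->] : 0 <= \prod_i F i /\
    Num.sqrt (\prod_i F i) = \prod_i Num.sqrt (F i) by [].
apply: (big_rec2 (fun a b => 0 <= a /\ Num.sqrt a = b)); first by rewrite sqrtr1.
by move=> i a b _ [a0 <-]; rewrite mulr_ge0 // sqrtrM.
Qed.

Lemma affinityC (R : realType) (p q : R) : affinity p q = affinity q p.
Proof. by rewrite /affinity mulrC [(1 - p) * _]mulrC. Qed.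

Lemma affinityxx (R : realType) (p : R) : 0 <= p <= 1 -> affinity p p = 1.
Proof.
move=> /andP[p0 p1]; rewrite /affinity -!expr2 !sqrtr_sqr !ger0_norm ?subr_ge0 //.
by rewrite addrC subrK.
Qed.

Definition cut_edges (n : nat) (t u : labeling n) : {set edge n} :=
  finset (fun e : edge n => (t (val e).1 == t (val e).2) !=
                            (u (val e).1 == u (val e).2)).

(** Affinities of product measures multiply; an edge to which both labelings
    give the same probability contributes a factor 1. *)
Lemma hellingerE (R : realType) (n : nat) (p q : R) (t u : labeling n)
    (p01 : 0 <= p <= 1) (q01 : 0 <= q <= 1) :
  hellinger p q t u = affinity p q ^+ #|cut_edges t u|.
Proof.
have Q01 (s : labeling n) e : 0 <= edge_prob p q s e <= 1.
  by rewrite /edge_prob; case: ifP.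
pose f (s : labeling n) (e : edge n) (b : bool) : R :=
  edge_prob p q s e ^+ b * (1 - edge_prob p q s e) ^+ (1 - b).
have f0 s e b : 0 <= f s e b.
  have /andP[Q0 Q1] := Q01 s e.
  by rewrite /f mulr_ge0 // exprn_ge0 // subr_ge0.
transitivity (\prod_(e : edge n) \sum_(b : bool) Num.sqrt (f t e b * f u e b)).
  rewrite bigA_distr_bigA; apply: eq_bigr => x _.
  by rewrite /sbm_pmf -big_split /= sqrt_prod // => e; rewrite mulr_ge0 // f0.
transitivity (\prod_(e : edge n) if e \in cut_edges t u then affinity p q else 1).
  apply: eq_bigr => e _.
  rewrite big_bool /f /= !expr1 !expr0 !mulr1 !mul1r inE.
  rewrite -/(affinity (edge_prob p q t e) (edge_prob p q u e)) /edge_prob.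
  by do 2![case: (_ == _)] => //=; rewrite ?affinityxx // affinityC.
by rewrite -big_mkcond prodr_const.
Qed.

Lemma affinity_ge0 (R : realType) (p q : R) : 0 <= affinity p q.
Proof. by rewrite addr_ge0 ?sqrtr_ge0. Qed.

(** Arithmetic-geometric mean bounds sqrt ((1 - p) (1 - q)) by 1 - (p + q) / 2,
    which leaves 1 - (sqrt p - sqrt q)^2 / 2; then
    p - q = (sqrt p - sqrt q) (sqrt p + sqrt q), where
    (sqrt p + sqrt q)^2 <= 2 (p + q). *)
Lemma affinity_le (R : realType) (p q : R)
    (p01 : 0 <= p <= 1) (q01 : 0 <= q <= 1) :
  affinity p q <= 1 - (p - q) ^+ 2 / (4 * (p + q)).
Proof.
case/andP: p01 => p0 p1; case/andP: q01 => q0 q1.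
rewrite /affinity !sqrtrM ?subr_ge0 //.
set a := Num.sqrt p; set b := Num.sqrt q.
set a' := Num.sqrt (1 - p); set b' := Num.sqrt (1 - q).
have ea : a ^+ 2 = p by rewrite sqr_sqrtr.
have eb : b ^+ 2 = q by rewrite sqr_sqrtr.
have ea' : a' ^+ 2 = 1 - p by rewrite sqr_sqrtr ?subr_ge0.
have eb' : b' ^+ 2 = 1 - q by rewrite sqr_sqrtr ?subr_ge0.
clearbody a b a' b'.
have ab' : a' * b' <= 1 - (p + q) / 2.
  have := sqr_ge0 (a' - b'); rewrite sqrrB ea' eb' -mulr_natr.
  by move: (a' * b') => w; clear; lra.
have ab : (p - q) ^+ 2 / (4 * (p + q)) <= (a - b) ^+ 2 / 2.
  have [->|pq0] := eqVneq (p + q) 0.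
    by rewrite mulr0 invr0 mulr0 divr_ge0 // sqr_ge0.
  have pq_gt0 : 0 < p + q by rewrite lt_neqAle eq_sym pq0 addr_ge0.
  rewrite ler_pdivrMr ?mulr_gt0 // -ea -eb.
  have -> : (a ^+ 2 - b ^+ 2) ^+ 2 = (a - b) ^+ 2 * (a + b) ^+ 2 by ring.
  have -> : (a - b) ^+ 2 / 2 * (4 * (a ^+ 2 + b ^+ 2)) =
            (a - b) ^+ 2 * (2 * (a ^+ 2 + b ^+ 2)) by field.
  apply: ler_wpM2l; first exact: sqr_ge0.
  rewrite -subr_ge0.
  have -> : 2 * (a ^+ 2 + b ^+ 2) - (a + b) ^+ 2 = (a - b) ^+ 2 by ring.
  exact: sqr_ge0.
apply: le_trans (_ : a * b + (1 - (p + q) / 2) <= _); first by rewrite lerD2l.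
move: ab; rewrite [(a - b) ^+ 2]sqrrB ea eb -mulr_natr.
by move: (a * b) (_ / (_ * _)) => w z; clear; lra.
Qed.

(** * Edges that separate two labelings *)

Lemma hammingE (n : nat) (t u : labeling n) :
  hamming t u = #|finset (fun i => t i != u i)|.
Proof.
rewrite /hamming -sum1_card [RHS]big_mkcond; apply: eq_bigr => i _.
by rewrite inE; case: (t i); case: (u i).
Qed.

(** The two labelings disagree on the status of an edge when exactly one of
    its endpoints lies in the set S where they differ.  Orienting such an edge
    from S to its complement reaches every pair of S x ~: S. *)
Lemma card_cut_edges (n : nat) (t u : labeling n) :
  (hamming t u * (n - hamming t u) <= #|cut_edges t u|)%N.
Proof.
rewrite hammingE; set S := finset _.
have cS : (n - #|S|)%N = #|~: S| by rewrite [in RHS]cardsCs finset.setCK card_ord.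
rewrite cS -cardsX.
(* The orientation of an edge from S to its complement. *)
pose f (e : edge n) : 'I_n * 'I_n :=
  if (val e).1 \in S then val e else ((val e).2, (val e).1).
apply: leq_trans (leq_imset_card f (cut_edges t u)).
apply/subset_leq_card/fintype.subsetP => -[i j]; rewrite !inE /= => /andP[iS].
rewrite negbK => /eqP jS.
have ij : i != j by apply: contra iS => /eqP ->; rewrite jS.
apply/imsetP; move: ij; rewrite neq_ltn => /orP[] ij.
- exists (exist _ (i, j) ij : edge n); last by rewrite /f /= inE iS.
  by rewrite inE /= jS; move: iS; case: (t i); case: (u i); case: (u j).
- exists (exist _ (j, i) ij : edge n); last by rewrite /f /= inE jS eqxx.
  by rewrite inE /= jS; move: iS; case: (t i); case: (u i); case: (u j).
Qed.

(** The product h (n - h) is the minimum of its two factors times their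
    maximum, and this maximum is at least n / 2. *)
Lemma kdist_cut_edges (n : nat) (t u : labeling n) :
  (kdist t u * n <= 2 * #|cut_edges t u|)%N.
Proof.
have := card_cut_edges t u; rewrite /kdist.
have : (hamming t u <= n)%N.
  by rewrite hammingE -[X in (_ <= X)%N]card_ord max_card.
by move: (hamming t u) #|_| => h D hn hD; nia.
Qed.

(** * Expected posterior mass *)

(** The normalizer Z is at least p_t and at least p_u, hence
    p_t p_u / Z <= sqrt (p_t p_u); summing over the graphs bounds the expected
    posterior mass of each u outside A.  Graphs where Z vanishes have p_t = 0, so
    the convention for the posterior there is harmless. *)
Lemma posterior_defect (R : realType) (n : nat) (p q : R) (t : labeling n)
    (A : {set labeling n}) (p01 : 0 <= p <= 1) (q01 : 0 <= q <= 1) :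
  t \in Theta n -> A \subset Theta n ->
  0 <= 1 - sbm_expectation p q t (posterior p q A) <=
    \sum_(u in Theta n :\: A) hellinger p q u t.
Proof.
move=> tT AT.
have pmf0 s x : 0 <= sbm_pmf p q s x by exact: sbm_pmf_ge0.
pose Z x := \sum_(s in Theta n) sbm_pmf p q s x.
have Zge s x : s \in Theta n -> sbm_pmf p q s x <= Z x.
  by move=> sT; rewrite /Z (bigD1 s) //= lerDl sumr_ge0.
have Z0 x : 0 <= Z x by exact: sumr_ge0.
have -> : 1 - sbm_expectation p q t (posterior p q A) =
    \sum_(u in Theta n :\: A)
      \sum_x sbm_pmf p q t x * sbm_pmf p q u x / Z x.
  (* The constant 1 is the total mass of P_t. *)
  rewrite -(@sum_sbm_pmf R n p q t) /sbm_expectation -sumrB exchange_big /=.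
  apply: eq_bigr => x _; rewrite /posterior -/(Z x).
  rewrite -mulr_suml -mulr_sumr -[X in X - _]mulr1 -mulrBr -mulrA.
  have [Zx0|Zx0] := eqVneq (Z x) 0.
    suff -> : sbm_pmf p q t x = 0 by rewrite !mul0r.
    by apply/eqP; rewrite eq_le pmf0 -{1}Zx0 Zge.
  congr (_ * _); rewrite -[X in X - _](mulfV Zx0) -mulrBl; congr (_ / _).
  by rewrite {1}/Z (big_setID A) /= (finset.setIidPr AT) [X in X - _]addrC addrK.
apply/andP; split.
  by do 2![apply: sumr_ge0 => ? _]; rewrite divr_ge0 // mulr_ge0.
apply: ler_sum => u; rewrite inE => /andP[_ uT].
apply: ler_sum => x _.
have [->|Zx0] := eqVneq (Z x) 0; first by rewrite invr0 mulr0 sqrtr_ge0.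
have Zx_gt0 : 0 < Z x by rewrite lt_neqAle eq_sym Zx0 Z0.
rewrite ler_pdivrMr // [sbm_pmf p q u x * _]mulrC.
rewrite -[leLHS]sqr_sqrtr ?mulr_ge0 // expr2 ler_wpM2l ?sqrtr_ge0 //.
by rewrite -(ger0_norm (Z0 x)) -sqrtr_sqr ler_wsqrtr // expr2 ler_pM ?Zge.
Qed.

(** Combines [affinity_le] and [kdist_cut_edges] through 1 - s <= exp (- s). *)
Lemma hellinger_le (R : realType) (n : nat) (p q : R) (t u : labeling n)
    (p01 : 0 <= p <= 1) (q01 : 0 <= q <= 1) :
  hellinger p q t u <=
    expR (- ((p - q) ^+ 2 / (4 * (p + q)) * ((kdist t u)%:R * n%:R / 2))).
Proof.
rewrite hellingerE //; set D := #|_|; set s := (p - q) ^+ 2 / _.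
have s0 : 0 <= s.
  case/andP: p01 => p0 _; case/andP: q01 => q0 _.
  by rewrite divr_ge0 ?sqr_ge0 // mulr_ge0 // addr_ge0.
have aff : affinity p q <= expR (- s).
  by apply: le_trans (affinity_le p01 q01) _; exact: expR_ge1Dx.
apply: le_trans (_ : expR (- s) ^+ D <= _).
  by apply: lerXn2r; rewrite ?nnegrE ?affinity_ge0 ?expR_ge0.
rewrite -expRM_natl ler_expR mulrN lerN2 mulrC ler_wpM2r //.
rewrite ler_pdivrMr // [leRHS]mulrC -!natrM ler_nat; exact: kdist_cut_edges.
Qed.

(** Rescaling by n turns the per-edge rate into the signal-to-noise ratio of
    the sparse regime, and the number of edges, of order k n, into k. *)
Lemma hellinger_sparse_le (R : realType) (n : nat) (c d : R) (t u : labeling n)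
    (n_gt0 : (0 < n)%N) (p01 : 0 <= c / n%:R <= 1) (q01 : 0 <= d / n%:R <= 1) :
  hellinger (c / n%:R) (d / n%:R) t u <=
    expR (- ((c - d) ^+ 2 / (2 * (c + d)) * (kdist t u)%:R / 4)).
Proof.
apply: le_trans (hellinger_le t u p01 q01) _; rewrite ler_expR lerN2 le_eqVlt.
apply/orP; left; apply/eqP.
have n0 : n%:R != 0 :> R by rewrite pnatr_eq0 -lt0n.
have [cd0|cd0] := eqVneq (c + d) 0.
  by rewrite -mulrDl cd0 mul0r !mulr0 invr0 !mulr0 !mul0r.
by field; rewrite n0.
Qed.

(** The radius 8 n / g makes each labeling outside the ball cost at least
    exp (- 2 n), more than the at most 2^n <= exp n such labelings can offset. *)
Lemma posterior_kball_ge (R : realType) (n : nat) (c d : R) (t : labeling n)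
    (g := (c - d) ^+ 2 / (2 * (c + d))) :
  (0 < n)%N -> 0 <= c / n%:R <= 1 -> 0 <= d / n%:R <= 1 -> t \in Theta n ->
  0 < g ->
  1 - expR (- n%:R) <=
    sbm_expectation (c / n%:R) (d / n%:R) t
      (posterior (c / n%:R) (d / n%:R) (kball t (8 / g * n%:R))) <= 1.
Proof.
move=> n_gt0 p01 q01 tT g_gt0; set A := kball _ _.
set E := sbm_expectation _ _ _ _.
have AT : A \subset Theta n.
  by apply/fintype.subsetP => u; rewrite !inE => /andP[].
have /andP[defect_ge0 defect_le] := posterior_defect p01 q01 tT AT.
rewrite -/E in defect_ge0 defect_le.
rewrite -(subr_ge0 E) defect_ge0 andbT.
rewrite lerBlDr -lerBlDl (le_trans defect_le) //.
apply: le_trans (_ : \sum_(u in Theta n :\: A) expR (- (2 * n%:R)) <= _).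
  apply: ler_sum => u; rewrite !inE => /andP[+ uT]; rewrite uT /= -ltNge => far.
  apply: le_trans (hellinger_sparse_le u t n_gt0 p01 q01) _.
  rewrite -/g ler_expR lerN2 ler_pdivlMr //.
  move: far => /ltW; rewrite -(ler_pM2l g_gt0) mulrA [g * (_ / _)]mulrC.
  rewrite divfK ?gt_eqF //.
  by apply: le_trans; rewrite mulrAC -natrM.
rewrite sumr_const -[leLHS]mulr_natl.
have -> : - n%:R = n%:R - 2 * n%:R :> R by ring.
rewrite expRD ler_pM2r ?expR_gt0 //.
apply: le_trans (_ : 2 ^+ n <= _).
  rewrite -natrX ler_nat (leq_trans (max_card _)) //.
  by rewrite card_ffun card_bool card_ord.
rewrite -[n%:R]mulr1 expRM_natl; apply: lerXn2r; rewrite ?nnegrE ?expR_ge0 //.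
exact: expR_ge1Dx.
Qed.

(** * Almost exact recovery *)

Unset Implicit Arguments.

Local Open Scope classical_set_scope.

Theorem corollary4p7 (R : realType) (c d : nat -> R)
  (theta : forall n : nat, labeling n)
  (c_ge0 : forall n : nat, (0 < n)%N -> 0 <= c n)
  (d_ge0 : forall n : nat, (0 < n)%N -> 0 <= d n)
  (c_o : c =o_\oo (fun n : nat => ln (n%:R : R)))
  (d_o : d =o_\oo (fun n : nat => ln (n%:R : R)))
  (p01 : forall n : nat, (0 < n)%N -> 0 <= c n / n%:R <= 1)
  (q01 : forall n : nat, (0 < n)%N -> 0 <= d n / n%:R <= 1)
  (thetaP : forall n : nat, (0 < n)%N -> theta n \in Theta n)
  (cd_oo : (c n - d n) ^+ 2 / (2 * (c n + d n)) @[n --> \oo] --> +oo) :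
  exists a : nat -> R,
    [/\ forall n : nat, (0 < n)%N -> 0 < a n < 1 / 2,
        a n @[n --> \oo] --> (0 : R) &
        sbm_expectation (c n / n%:R) (d n / n%:R) (theta n)
          (posterior (c n / n%:R) (d n / n%:R)
             (kball (theta n) (a n * n%:R))) @[n --> \oo] --> (1 : R)].
Proof.
pose g n := (c n - d n) ^+ 2 / (2 * (c n + d n)).
have g_large (M : R) : \forall n \near \oo, M <= g n by move/cvgryPge: cd_oo.
(* The bound 0 < a n < 1 / 2 is required for every n, so the rate 8 / g n is
   used only once it is at most 1 / 4; the other values are arbitrary. *)
pose a n : R := if 32 <= g n then 8 / g n else 1 / 4.
have aE : \forall n \near \oo, a n = 8 / g n.
  by near do rewrite /a ifT //; exact: g_large.
exists a; split.
- move=> n _; rewrite /a; case: ifP => [g32|_]; last by apply/andP; split; lra.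
  have g_gt0 : 0 < g n by apply: lt_le_trans g32.
  by rewrite divr_gt0 //= ltr_pdivrMr //; lra.
- apply/cvgrPdist_le => e e_gt0; near=> n.
  have g_gt0 : 0 < g n by apply: lt_le_trans (_ : 1 <= _) => //; near: n.
  have -> : a n = 8 / g n by near: n.
  rewrite sub0r normrN ger0_norm; last by rewrite divr_ge0 ?(ltW g_gt0).
  suff : 8 / e <= g n by rewrite !ler_pdivrMr // mulrC.
  by near: n; exact: g_large.
- apply: (@squeeze_cvgr _ _ _ _ (fun n => 1 - expR (- n%:R)) (fun=> 1)).
  + near=> n.
    have n_gt0 : (0 < n)%N by near: n; exact: nbhs_infty_gt.
    have -> : a n = 8 / g n by near: n.
    apply: posterior_kball_ge; rewrite ?p01 ?q01 ?thetaP //.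
    by apply: lt_le_trans (_ : 1 <= _) => //; near: n.
  + rewrite -[X in _ --> X]subr0; apply: cvgB; first exact: cvg_cst.
    exact: cvgn_expR.
  + exact: cvg_cst.
Unshelve. all: by end_near.
Qed.
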